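(* (i) Let $\Omega\subset\mathbb{R}^n$ be a convex domain and $\phi:\overline\Omega\to\mathbb{R}$ a convex function satisfying the structural conditions (H) with constants $\rho,\lambda,\Lambda>0$, and let $\theta_*$ be the engulfing constant. Then the sections of $\phi$ satisfy the separating property with the constant $\theta_*^2$; that is, for all $x,y\in\overline\Omega$ and $t>0$, if $y\notin S_\phi(x,t)$, then $$S_\phi\Big(y,\frac{t}{\theta_*^2}\Big)\cap S_\phi\Big(x,\frac{t}{\theta_*^2}\Big)=\emptyset.$$ (ii) Conversely, let $\phi$ be a convex function defined on a convex domain $\Omega$ (not necessarily satisfying (H)) whose sections satisfy the separating property with the constant $\theta$. Then the sections of $\phi$ satisfy the engulfing property with the constant $\theta^2$.
   Context: Structural conditions (H) with constants $\rho,\lambda,\Lambda>0$: (1) $\Omega\subset B_{1/\rho}$ (the ball of radius $1/\rho$ centered at the origin), and for every $x_0\in\partial\Omega$ there is an open ball of radius $\rho$ contained in $\Omega$ and tangent to $\partial\Omega$ at $x_0$; (2) $\phi\in C^{0,1}(\overline\Omega)\cap C^2(\Omega)$ is convex and $\det D^2\phi=g$ in $\Omega$ with $0<\lambda\le g\le\Lambda$; (3) $\rho|x-x_0|^2\le\phi(x)-\phi(x_0)-\nabla\phi(x_0)\cdot(x-x_0)\le\rho^{-1}|x-x_0|^2$ for all $x,x_0\in\partial\Omega$. At boundary points, $\nabla\phi(x_0)$ denotes the value of the continuous extension of $\nabla\phi$ to $\overline\Omega$. In (ii), $\phi$ is understood to be such that $\nabla\phi(x)$ is defined at every $x\in\overline\Omega$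 in this sense, so that its sections make sense. The section of $\phi$ centered at $x\in\overline\Omega$ with height $h>0$ is $S_\phi(x,h):=\{y\in\overline\Omega:\ \phi(y)<\phi(x)+\nabla\phi(x)\cdot(y-x)+h\}$. Engulfing property with constant $\theta>0$: for all $x\in\overline\Omega$, $t>0$ and $y\in S_\phi(x,t)$ one has $S_\phi(x,t)\subset S_\phi(y,\theta t)$. Separating property with constant $\theta>0$: for all $x,y\in\overline\Omega$ and $t>0$, if $y\notin S_\phi(x,t)$ then $S_\phi(y,t/\theta)\cap S_\phi(x,t/\theta)=\emptyset$. The engulfing constant $\theta_*>0$ is a fixed constant depending only on $\rho,\lambda,\Lambda,n$ such that the sections of every $\phi$ satisfying (H) with constants $\rho,\lambda,\Lambda$ have the engulfing property with constant $\theta_*$ (such a constant exists). *)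

(* Defs.v *)
From mathcomp Require Import all_boot all_order all_algebra.
From mathcomp Require Import all_classical all_reals all_analysis.
Import Order.TTheory GRing.Theory Num.Theory.
Import numFieldNormedType.Exports.

Set Implicit Arguments.
Unset Strict Implicit.
Unset Printing Implicit Defensive.

Local Open Scope classical_set_scope.
Local Open Scope ring_scope.

Section MongeAmpereSections.
Context {R : realType} {n : nat}.
Implicit Types (x y z u v : 'rV[R]_n) (Omega : set 'rV[R]_n).
Implicit Types (f phi : 'rV[R]_n -> R).

(* The library norm `|x| on 'rV[R]_n is the sup norm: it induces the usual
   topology, but balls and quadratic bounds need the Euclidean norm. *)
Definition dot u v : R := \sum_(i < n) u 0 i * v 0 i.

Definition enorm v : R := Num.sqrt (dot v v).

Definition eball x (r : R) : set 'rV[R]_n := [set y | enorm (y - x) < r].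

Definition boundary Omega := closure Omega `\` interior Omega.

(* A convex set is connected, so connectedness of the domain is automatic. *)
Definition convex_domain Omega :=
  [/\ Omega !=set0, open Omega & convex_set Omega].

Definition partial (i : 'I_n) f x : R := 'D_(delta_mx 0 i) f x.

Definition gradient f x : 'rV[R]_n := \row_(i < n) partial i f x.

Definition hessian f x : 'M[R]_n :=
  \matrix_(i < n, j < n) partial j (partial i f) x.

Fixpoint Ck (k : nat) Omega f : Prop :=
  (forall x, Omega x -> {for x, continuous f}) /\
  match k with
  | 0 => True
  | k'.+1 => forall i : 'I_n,
      (forall x, Omega x -> derivable f x (delta_mx 0 i)) /\
      Ck k' Omega (partial i f)
  end.

Definition gradient_extends Omega phi :=
  (forall x, Omega x -> differentiable phi x) /\
  exists G : 'rV[R]_n -> 'rV[R]_n,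
    {within closure Omega, continuous G} /\
    forall x, Omega x -> G x = gradient phi x.

(* Functions on the closure of Omega are represented by total functions phi
   whose values outside that closure are irrelevant.  At a boundary point,
   [gradient phi] would depend on those values and is not used: the gradient
   there is the limit of the gradient from inside Omega, which is the value of
   its continuous extension when [gradient_extends Omega phi] holds. *)
Definition egradient Omega phi x : 'rV[R]_n :=
  if x \in Omega then gradient phi x
  else lim (gradient phi y @[y --> within Omega (nbhs x)]).

Definition phi_section Omega phi x (h : R) : set 'rV[R]_n :=
  [set y | closure Omega y /\
    phi y < phi x + dot (egradient Omega phi x) (y - x) + h].

Definition engulfing Omega phi (theta : R) :=
  forall x (t : R) y, closure Omega x -> 0 < t ->
    phi_section Omega phi x t y ->
    phi_section Omega phi x t `<=` phi_section Omega phi y (theta * t).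

Definition separating Omega phi (theta : R) :=
  forall x y (t : R), closure Omega x -> closure Omega y -> 0 < t ->
    ~ phi_section Omega phi x t y ->
    phi_section Omega phi y (t / theta) `&` phi_section Omega phi x (t / theta)
      = set0.

(* [sc_gradient] makes explicit what the boundary gradients in [sc_quadratic]
   presuppose. An open ball contained in Omega is tangent to the boundary of
   Omega at x0 when x0 lies on the bounding sphere. *)
Record structural_conditions (rho lambda Lambda : R) Omega phi : Prop := {
  sc_bounded : Omega `<=` eball 0 rho^-1;
  sc_interior_ball : forall x0, boundary Omega x0 ->
    exists z, eball z rho `<=` Omega /\ enorm (x0 - z) = rho;
  sc_lipschitz : [lipschitz phi x | x in closure Omega];
  sc_C2 : Ck 2 Omega phi;
  sc_convex : convex_function (closure Omega) phi;
  sc_monge_ampere : exists g : 'rV[R]_n -> R, forall x, Omega x ->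
    \det (hessian phi x) = g x /\ lambda <= g x <= Lambda;
  sc_gradient : gradient_extends Omega phi;
  sc_quadratic : forall x x0, boundary Omega x -> boundary Omega x0 ->
    rho * enorm (x - x0) ^+ 2
      <= phi x - phi x0 - dot (egradient Omega phi x0) (x - x0)
      <= rho^-1 * enorm (x - x0) ^+ 2
}.

End MongeAmpereSections.

Definition engulfing_constant {R : realType} (n : nat)
    (rho lambda Lambda theta : R) :=
  0 < theta /\
  forall (Omega : set 'rV[R]_n) (phi : 'rV[R]_n -> R),
    convex_domain Omega -> structural_conditions rho lambda Lambda Omega phi ->
    engulfing Omega phi theta.

(* Main.v *)
Require Import Defs.
From mathcomp Require Import all_boot all_order all_algebra.
From mathcomp Require Import all_classical all_reals all_analysis.
Import Order.TTheory GRing.Theory Num.Theory.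
Import numFieldNormedType.Exports.

Local Open Scope classical_set_scope.
Local Open Scope ring_scope.

(** Read [z] in the section of [x] with height [t] as the assertion that [z] is
    at quasi-distance less than [t] from [x]. Sections of positive height
    contain their centers, so both properties are forms of a quasi-triangle
    inequality, and each follows from the other by applying it twice. The cost
    is one factor [theta] per application, whence the squares.

    From engulfing to separating ([engulfing_separating]): a common point [z]
    of two sections of height [t / theta ^+ 2] has both centers in its section
    of height [t / theta], and engulfing at [z] puts the second center in the
    section of the first of height [t].

    From separating to engulfing ([separating_engulfing]): separation gives
    symmetry of the quasi-distance up to the factor [theta]
    ([separating_section_sym]), so [x] lies in the sections of height
    [theta * t] of any two points [y], [z] of its section of height [t]. These
    sections meet, hence [z] cannot lie outside the section of [y] of height
    [theta ^+ 2 * t]. *)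

Lemma phi_section_center (R : realType) (n : nat) (Omega : set 'rV[R]_n)
    (phi : 'rV[R]_n -> R) (x : 'rV[R]_n) (h : R) :
  closure Omega x -> 0 < h -> phi_section Omega phi x h x.
Proof.
move=> clx h_gt0; split => //.
have -> : dot (egradient Omega phi x) (x - x) = 0.
  by rewrite /dot subrr big1 // => i _; rewrite mxE mulr0.
by rewrite addr0 ltrDl.
Qed.

(** The section of [x] contains its own center, so engulfing it puts [x] in
    the enlarged section of [y]. *)
Lemma engulfing_section_sym (R : realType) (n : nat) (Omega : set 'rV[R]_n)
    (phi : 'rV[R]_n -> R) (theta : R) (x y : 'rV[R]_n) (t : R) :
  engulfing Omega phi theta -> closure Omega x -> 0 < t ->
  phi_section Omega phi x t y -> phi_section Omega phi y (theta * t) x.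
Proof.
move=> eng clx t_gt0 xy; apply: (eng x t y clx t_gt0 xy).
exact: phi_section_center.
Qed.

Lemma engulfing_separating (R : realType) (n : nat) (Omega : set 'rV[R]_n)
    (phi : 'rV[R]_n -> R) (theta : R) :
  0 < theta -> engulfing Omega phi theta ->
  separating Omega phi (theta ^+ 2).
Proof.
move=> th_gt0 eng x y t clx cly t_gt0 nxy.
apply/seteqP; split => // z [yz xz]; apply: nxy.
have th_neq0 := lt0r_neq0 th_gt0.
have s_gt0 : 0 < t / theta ^+ 2 by rewrite divr_gt0 // exprn_gt0.
have sE : theta * (t / theta ^+ 2) = t / theta.
  by rewrite expr2 invfM mulrCA mulVKf.
have zx := engulfing_section_sym _ _ _ _ _ _ _ _ eng clx s_gt0 xz.
have zy := engulfing_section_sym _ _ _ _ _ _ _ _ eng cly s_gt0 yz.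
rewrite sE in zx zy.
have r_gt0 : 0 < t / theta by rewrite divr_gt0.
have := eng z (t / theta) x xz.1 r_gt0 zx y zy.
by rewrite mulrC divfK.
Qed.

(** If [x] were outside the section of [y], the sections of [x] and [y] of
    height [t] would be disjoint, although both contain [y]. *)
Lemma separating_section_sym (R : realType) (n : nat) (Omega : set 'rV[R]_n)
    (phi : 'rV[R]_n -> R) (theta : R) (x y : 'rV[R]_n) (t : R) :
  0 < theta -> separating Omega phi theta -> closure Omega x -> 0 < t ->
  phi_section Omega phi x t y -> phi_section Omega phi y (theta * t) x.
Proof.
move=> th_gt0 sep clx t_gt0 xy; apply: contrapT => nyx.
have := sep y x (theta * t) xy.1 clx (mulr_gt0 th_gt0 t_gt0) nyx.
rewrite mulrC mulKf ?lt0r_neq0 // => /seteqP[+ _] => /(_ y); apply.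
by split=> //; apply: phi_section_center => //; exact: xy.1.
Qed.

Lemma separating_engulfing (R : realType) (n : nat) (Omega : set 'rV[R]_n)
    (phi : 'rV[R]_n -> R) (theta : R) :
  0 < theta -> separating Omega phi theta ->
  engulfing Omega phi (theta ^+ 2).
Proof.
move=> th_gt0 sep x t y clx t_gt0 xy z xz; apply: contrapT => nyz.
have s_gt0 : 0 < theta ^+ 2 * t by rewrite mulr_gt0 // exprn_gt0.
have := sep y z (theta ^+ 2 * t) xy.1 xz.1 s_gt0 nyz.
have -> : theta ^+ 2 * t / theta = theta * t.
  by rewrite expr2 mulrAC mulfK ?lt0r_neq0.
move=> /seteqP[+ _] => /(_ x); apply.
by split; apply: separating_section_sym.
Qed.

Theorem proposition2p2 (R : realType) (n : nat) (n_gt0 : (0 < n)%N) :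
  (forall rho lambda Lambda theta_s : R,
     0 < rho -> 0 < lambda -> 0 < Lambda ->
     engulfing_constant n rho lambda Lambda theta_s ->
     forall (Omega : set 'rV[R]_n) (phi : 'rV[R]_n -> R),
       convex_domain Omega ->
       structural_conditions rho lambda Lambda Omega phi ->
       separating Omega phi (theta_s ^+ 2))
  /\
  (forall (Omega : set 'rV[R]_n) (phi : 'rV[R]_n -> R),
     convex_domain Omega ->
     convex_function (closure Omega) phi ->
     gradient_extends Omega phi ->
     forall theta : R, 0 < theta ->
       separating Omega phi theta ->
       engulfing Omega phi (theta ^+ 2)).
Proof.
split.
- move=> rho lambda Lambda theta_s _ _ _ [th_gt0 eng] Omega phi cO sc.
  by apply: engulfing_separating => //; exact: eng.
- by move=> Omega phi _ _ _ theta; exact: separating_engulfing.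
Qed.
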